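(* Let $f(z)=z^{p}+\sum_{k=n}^{\infty}a_{k+p}z^{k+p}$ and $g(z)=z^{p}+\sum_{k=n}^{\infty}b_{k+p}z^{k+p}$ belong to $\mathcal{F}(\lambda,m,\Omega)$, where $p>m$. Suppose that for some real $\alpha,\beta$ with $-\pi\le\alpha-\beta\le\pi$ and some $\delta>\frac{p!}{(p+n-m)(p-m-1)!}\sqrt{2[1-\cos(\alpha-\beta)]}$, $$\left|\frac{e^{i\alpha}\mathcal{F}'(f^{(m)}(z))}{z^{p-m-1}}-\frac{e^{i\beta}\mathcal{F}'(g^{(m)}(z))}{z^{p-m-1}}\right|<\delta(p+n-m)-\frac{p!}{(p-m-1)!}\sqrt{2[1-\cos(\alpha-\beta)]}\qquad(z\in\mathcal{U}).$$ Then $$\left|\frac{e^{i\alpha}\mathcal{F}(f^{(m)}(z))}{z^{p-m}}-\frac{e^{i\beta}\mathcal{F}(g^{(m)}(z))}{z^{p-m}}\right|<\delta+\frac{p!}{(p-m)!}\sqrt{2[1-\cos(\alpha-\beta)]}\qquad(z\in\mathcal{U}).$$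
   Context: Let $\mathcal{U}=\{z\in\mathbb{C}:|z|<1\}$, $\mathbb{N}=\{1,2,3,\dots\}$, $\mathbb{N}_0=\mathbb{N}\cup\{0\}$. Throughout $n,p\in\mathbb{N}$, $m,\Omega\in\mathbb{N}_0$, $p>m$, $0\le\lambda\le1$, and the coefficients are complex. For $f(z)=z^{p}+\sum_{k=n}^{\infty}a_{k+p}z^{k+p}$ analytic in $\mathcal{U}$, $f^{(m)}$ is its $m$-th derivative. The (Salagean type) operator is $D^{0}f^{(m)}(z)=f^{(m)}(z)$, $D^{1}f^{(m)}(z)=\frac{z}{p-m}(f^{(m)}(z))'$, $D^{\Omega}f^{(m)}=D(D^{\Omega-1}f^{(m)})$. Define $$\mathcal{F}(f^{(m)}(z))=(1-\lambda)D^{\Omega}f^{(m)}(z)+\frac{\lambda z}{p-m}\left(D^{\Omega}f^{(m)}(z)\right)'=\frac{p!}{(p-m)!}z^{p-m}+\sum_{k=n}^{\infty}\frac{(k+p)!(k+p-m)^{\Omega}(1+\lambda k(p-m)^{-1})}{(p-m)^{\Omega}(k+p-m)!}a_{k+p}z^{k+p-m}.$$ ''$f\in\mathcal{F}(\lambda,m,\Omega)$'' means that $f(z)=z^{p}+\sum_{k\ge n}a_{k+p}z^{k+p}$ has coefficients such that this last function is analytic in $\mathcal{U}$ (equivalently, $f$ is analytic in $\mathcal{U}$). $\mathcal{F}'(f^{(m)}(z))$ denotes the derivative with respect to $z$ of $\mathcal{F}(f^{(m)}(z))$; quotients by powers of $z$ are understood at $z=0$ by removing the singularity. *)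

(* Defs.v *)
From Stdlib Require Import Reals Factorial.
From Coquelicot Require Import Coquelicot.
Local Open Scope C_scope.

Definition unit_disc (z : C) : Prop := (Cmod z < 1)%R.

Definition cis (t : R) : C := (cos t, sin t).

(* Coquelicot's [C_derive] and [C_lim] are total operators. They return the
   complex derivative (resp. punctured limit) whenever it exists, by
   [is_C_derive_unique] and [is_C_lim_unique], and a junk value otherwise.
   Here they are only applied to functions that are analytic in the disc,
   or to quotients of such functions with a removable singularity at 0. *)
Fixpoint C_derive_n (f : C -> C) (m : nat) : C -> C :=
  match m with
  | O => f
  | S k => C_derive (C_derive_n f k)
  end.

(* The natural-number subtraction [p - m] is only used when [m < p]. *)
Definition salagean (p m : nat) (h : C -> C) (z : C) : C :=
  z / INR (p - m) * C_derive h z.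

Fixpoint salagean_n (p m Om : nat) (h : C -> C) : C -> C :=
  match Om with
  | O => h
  | S k => salagean p m (salagean_n p m k h)
  end.

Definition calF (p m Om : nat) (lam : R) (f : C -> C) (z : C) : C :=
  (1 - lam) * salagean_n p m Om (C_derive_n f m) z
  + lam * z / INR (p - m) * C_derive (salagean_n p m Om (C_derive_n f m)) z.

(* f(z) = z^p + \sum_{k >= n} a_{k+p} z^{k+p} in the disc; [a] is indexed by
   the exponent, and the summation index is k = n + j. *)
Definition has_expansion (n p : nat) (a : nat -> C) (f : C -> C) : Prop :=
  forall z : C, unit_disc z ->
    is_series (fun j : nat => a (n + j + p)%nat * z ^ (n + j + p)) (f z - z ^ p).

(* The coefficient of z^{k+p-m} in the expansion of [calF p m Om lam f]. *)
Definition calF_coeff (p m Om : nat) (lam : R) (a : nat -> C) (k : nat) : C :=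
  RtoC (INR (fact (k + p)) * INR (k + p - m) ^ Om * (1 + lam * INR k / INR (p - m))
        / (INR (p - m) ^ Om * INR (fact (k + p - m))))
  * a (k + p)%nat.

(* The power series of [calF p m Om lam f] is analytic in the disc exactly
   when it converges at every point of the disc. *)
Definition in_class (n p : nat) (lam : R) (m Om : nat) (f : C -> C) : Prop :=
  exists a : nat -> C,
    has_expansion n p a f /\
    forall z : C, unit_disc z ->
      ex_series (fun j : nat =>
        calF_coeff p m Om lam a (n + j) * z ^ (n + j + p - m)).

(* h(z) / z^j, with the singularity at z = 0 removed. *)
Definition quot_pow (h : C -> C) (j : nat) (z : C) : C :=
  if Ceq_dec z 0 then C_lim (fun w : C => h w / w ^ j) 0 else h z / z ^ j.

(* Main.v *)
Require Import Defs.
From Stdlib Require Import Reals Factorial Arith Lra Lia List.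
From Coquelicot Require Import Coquelicot.
Import ListNotations.
Local Open Scope R_scope.

(** Put [q = p - m]. The two quotients are power series: with [H(z) = d_0 + sum_(k >= n) d_k z^k] the
    second one, the first is [K(z) = sum (k + q) d_k z^k], and
    [|d_0| = p! / q! * |e^(i alpha) - e^(i beta)|]. So [K - q d_0] is bounded by [delta (q + n)] and
    vanishes to order [n] at 0; by Schwarz's lemma the same bound holds for
    [h(z) = (K(z) - q d_0) / z^n]. Dividing the [k]-th coefficient of [h] by [k + q + n] amounts to
    integrating [t^(q+n-1) h(t z)] over [0 <= t <= 1], which gives
    [|H(z) - d_0| <= delta |z|^n < delta]. The maximum modulus principle behind Schwarz's lemma is
    obtained for polynomials from interpolation at roots of unity and Landau's power trick, then for
    power series by truncation. *)

(** * Complex series and radii of convergence *)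

Definition pow_series (c : nat -> C) (h : C -> C) : Prop :=
  forall z : C, unit_disc z -> is_series (fun k : nat => (c k * z ^ k)%C) (h z).

(** Here and in the next four lemmas, facts about general normed modules are fixed to [C], so that
    terms and limits are written with the complex operations and [ring] applies to them. *)
Lemma is_series_Cscal (s : C) (a : nat -> C) (l : C) :
  is_series a l -> is_series (fun k => (s * a k)%C) (s * l)%C.
Proof. exact (is_series_scal s a l). Qed.

Lemma is_series_Cplus (a b : nat -> C) (la lb : C) :
  is_series a la -> is_series b lb -> is_series (fun k => (a k + b k)%C) (la + lb)%C.
Proof. exact (is_series_plus a b la lb). Qed.

Lemma is_series_Cminus (a b : nat -> C) (la lb : C) :
  is_series a la -> is_series b lb -> is_series (fun k => (a k - b k)%C) (la - lb)%C.
Proof. exact (is_series_minus a b la lb). Qed.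

Lemma is_series_Cext (a b : nat -> C) (l : C) :
  (forall k, a k = b k) -> is_series a l -> is_series b l.
Proof. exact (is_series_ext a b l). Qed.

Lemma is_series_C_unique (a : nat -> C) (l l' : C) :
  is_series a l -> is_series a l' -> l = l'.
Proof. exact (filterlim_locally_unique (sum_n a) l l'). Qed.

(** The triangle inequality for partial sums passes to the limit; this is the domination step of the
    later termwise estimates. *)
Lemma Cmod_series_le (a : nat -> C) (b : nat -> R) (l : C) (L : R) :
  is_series a l -> is_series b L -> (forall k, Cmod (a k) <= b k) -> Cmod l <= L.
Proof.
  intros Ha Hb Hab.
  refine (filterlim_le (F := eventually) (fun n => Cmod (sum_n a n)) (sum_n b) (Cmod l) L _ _ _).
  - exists 0%nat; intros n _.
    eapply Rle_trans; [exact (norm_sum_n_m a 0 n)|].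
    apply sum_n_m_le, Hab.
  - exact (filterlim_comp _ _ _ _ _ _ _ _ Ha (filterlim_norm l)).
  - exact Hb.
Qed.

(** Each term is a difference of consecutive partial sums, and convergent partial sums are
    bounded. *)
Lemma ex_series_Cmod_bounded (a : nat -> C) :
  ex_series a -> exists M, forall k, Cmod (a k) <= M.
Proof.
  intros [l Hl].
  destruct (filterlim_bounded (sum_n a) (ex_intro _ l Hl)) as [M HM].
  exists (M + M); intros [|k].
  - generalize (HM 0%nat) (Cmod_ge_0 (a 0%nat)); rewrite sum_O.
    change (norm (a 0%nat)) with (Cmod (a 0%nat)); lra.
  - replace (a (S k)) with (sum_n a (S k) - sum_n a k)%C.
    + eapply Rle_trans; [apply Cmod_triangle|].
      rewrite Cmod_opp.
      apply Rplus_le_compat; [exact (HM (S k))|exact (HM k)].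
    + rewrite sum_Sn; change plus with Cplus; ring.
Qed.

Lemma CV_radius_ge (b : nat -> R) (r M : R) :
  (forall k, Rabs (b k * r ^ k) <= M) -> Rbar_le r (CV_radius b).
Proof.
  intros H; apply (proj1 (CV_radius_bounded b)); now exists M.
Qed.

Lemma RtoC_disc (x : R) : 0 <= x < 1 -> unit_disc x.
Proof. intros H; unfold unit_disc; rewrite Cmod_R, Rabs_pos_eq; lra. Qed.

(** At the midpoint [(1 + x) / 2] the series converges, so its terms are bounded there, which puts
    the radius of the series of moduli above [x]. Absolute convergence is thereby read off real
    power series. *)
Lemma pow_series_CV_radius (c : nat -> C) (h : C -> C) (x : R) :
  pow_series c h -> 0 <= x < 1 -> Rbar_lt x (CV_radius (fun k => Cmod (c k))).
Proof.
  intros Hc Hx.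
  assert (Hr : 0 <= (1 + x) / 2 < 1) by lra.
  destruct (ex_series_Cmod_bounded _ (ex_intro _ _ (Hc _ (RtoC_disc _ Hr)))) as [M HM].
  apply Rbar_lt_le_trans with ((1 + x) / 2); [simpl; lra|].
  apply CV_radius_ge with M; intros k.
  specialize (HM k); rewrite Cmod_mult, Cmod_pow, Cmod_R, (Rabs_pos_eq ((1 + x) / 2)) in HM by lra.
  rewrite Rabs_pos_eq; [exact HM|].
  apply Rmult_le_pos; [apply Cmod_ge_0|apply pow_le; lra].
Qed.

Lemma ex_series_CV_radius (b : nat -> R) (r : R) :
  (forall k, 0 <= b k) -> 0 <= r -> Rbar_lt r (CV_radius b) ->
  ex_series (fun k => b k * r ^ k).
Proof.
  intros Hb Hr H.
  apply ex_series_ext with (fun k => Rabs (b k * r ^ k)).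
  - intros k; apply Rabs_pos_eq, Rmult_le_pos; [apply Hb|now apply pow_le].
  - apply CV_disk_inside; rewrite Rabs_pos_eq; assumption.
Qed.

(** Multiplying by [INR k] is differentiation followed by a shift of one index, and neither changes
    the radius. *)
Lemma CV_radius_mult_INR (b : nat -> R) : CV_radius (fun k => INR k * b k) = CV_radius b.
Proof.
  rewrite <- (CV_radius_derive b), <- (CV_radius_incr_1 (PS_derive b)).
  apply CV_radius_ext; intros [|k]; simpl.
  - change zero with 0; lra.
  - reflexivity.
Qed.

(** * Termwise differentiation *)

Definition deriv_coef (c : nat -> C) (k : nat) : C := (INR (S k) * c (S k))%C.

(** The remainder for [S (S k)] is [w] times the one for [S k] plus
    [INR (S k) * z ^ k * (w - z) ^ 2], so the constants need only [x ^ 2 + x <= (x + 1) ^ 2]. The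
    quotient [r ^ S k / r ^ 2] stands for the power of exponent [k - 1], which is negative at
    [k = 0]. *)
Lemma Cpow_remainder (r : R) (w z : C) (k : nat) :
  0 < r -> Cmod w <= r -> Cmod z <= r ->
  Cmod (w ^ S k - z ^ S k - INR (S k) * z ^ k * (w - z))
  <= INR (S k) ^ 2 * r ^ S k / r ^ 2 * Cmod (w - z) ^ 2.
Proof.
  intros Hr Hw Hz.
  induction k as [|k IH].
  - replace (w ^ 1 - z ^ 1 - INR 1 * z ^ 0 * (w - z))%C with (RtoC 0) by (simpl; ring).
    rewrite Cmod_0.
    apply Rmult_le_pos; [|apply pow2_ge_0].
    apply Rmult_le_pos; [simpl; lra|].
    apply Rlt_le, Rinv_0_lt_compat, pow_lt, Hr.
  - replace (w ^ S (S k) - z ^ S (S k) - INR (S (S k)) * z ^ S k * (w - z))%C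
      with (w * (w ^ S k - z ^ S k - INR (S k) * z ^ k * (w - z))
            + INR (S k) * z ^ k * (w - z) ^ 2)%C
      by (rewrite (S_INR (S k)), RtoC_plus, !Cpow_S; simpl; ring).
    eapply Rle_trans; [apply Cmod_triangle|].
    rewrite !Cmod_mult, !Cmod_pow, Cmod_R, (Rabs_pos_eq _ (pos_INR _)).
    set (d := Cmod (w - z)) in *.
    apply Rle_trans with
      (r * (INR (S k) ^ 2 * r ^ S k / r ^ 2 * d ^ 2) + INR (S k) * r ^ k * d ^ 2).
    + apply Rplus_le_compat.
      * apply Rmult_le_compat; try apply Cmod_ge_0; assumption.
      * apply Rmult_le_compat_r; [apply pow2_ge_0|].
        apply Rmult_le_compat_l; [apply pos_INR|].
        apply pow_incr; split; [apply Cmod_ge_0|assumption].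
    + rewrite (S_INR (S k)).
      set (x := INR (S k)).
      assert (Hx : 0 <= x) by apply pos_INR.
      replace (r * (x ^ 2 * r ^ S k / r ^ 2 * d ^ 2) + x * r ^ k * d ^ 2)
        with ((x ^ 2 + x) * (r ^ k * d ^ 2)) by (simpl; field; lra).
      replace ((x + 1) ^ 2 * r ^ S (S k) / r ^ 2 * d ^ 2)
        with ((x + 1) ^ 2 * (r ^ k * d ^ 2)) by (simpl; field; lra).
      apply Rmult_le_compat_r; [|nra].
      apply Rmult_le_pos; [apply pow_le; lra|apply pow2_ge_0].
Qed.

(** A linear error bound squeezes the punctured limit; this one criterion serves both derivatives
    and removable singularities. *)
Lemma C_lim_lipschitz (f : C -> C) (z l : C) (rho K : R) :
  0 < rho ->
  (forall w, w <> z -> Cmod (w - z) < rho -> Cmod (f w - l) <= K * Cmod (w - z)) ->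
  C_lim f z = l.
Proof.
  intros Hrho H.
  apply is_C_lim_unique, filterlim_locally; intros eps.
  assert (HK : 0 < Rabs K + 1) by (generalize (Rabs_pos K); lra).
  set (d := Rmin rho (eps / (Rabs K + 1))).
  assert (Hd : 0 < d).
  { apply Rmin_glb_lt; [exact Hrho|].
    apply Rdiv_lt_0_compat; [apply cond_pos|exact HK]. }
  (* Balls of [C] are coordinatewise, so radius [d / 2] only gives modulus below [sqrt 2 * (d / 2)],
     which is still less than [d]. *)
  assert (Hd2 : 0 < d / 2) by lra.
  exists (mkposreal _ Hd2); intros w Hw Hwz.
  apply C_NormedModule_mixin_compat1.
  assert (Hwd : Cmod (w - z) < d).
  { eapply Rlt_trans; [exact (C_NormedModule_mixin_compat2 _ _ _ Hw)|].
    simpl.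
    assert (sqrt 2 < 2) by (rewrite <- (sqrt_Rsqr 2) at 2 by lra; apply sqrt_lt_1; unfold Rsqr; lra).
    nra. }
  change (minus (f w) l) with (f w - l)%C.
  assert (Hwr : Cmod (w - z) < rho) by (eapply Rlt_le_trans; [exact Hwd|apply Rmin_l]).
  eapply Rle_lt_trans; [exact (H w Hwz Hwr)|].
  assert (Hwe : Cmod (w - z) < eps / (Rabs K + 1))
    by (eapply Rlt_le_trans; [exact Hwd|apply Rmin_r]).
  apply Rle_lt_trans with ((Rabs K + 1) * Cmod (w - z)).
  - apply Rmult_le_compat_r; [apply Cmod_ge_0|generalize (Rle_abs K); lra].
  - apply (Rmult_lt_compat_l _ _ _ HK) in Hwe.
    replace ((Rabs K + 1) * (eps / (Rabs K + 1))) with (pos eps) in Hwe by (field; lra).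
    exact Hwe.
Qed.

(** The difference quotient minus the termwise derivative is controlled term by term by
    [Cpow_remainder]. The error is therefore at most [B / r ^ 2 * Cmod (w - z)], where [B] is the
    sum of [k^2 |c_k| r^k] at a radius [r] between [Cmod z] and 1. *)
Lemma pow_series_C_derive (c : nat -> C) (h : C -> C) :
  pow_series c h -> pow_series (deriv_coef c) (C_derive h).
Proof.
  intros Hc z Hz.
  set (r := (1 + Cmod z) / 2).
  assert (Hz0 := Cmod_ge_0 z).
  unfold unit_disc in Hz.
  assert (Hr : 0 <= r < 1) by (unfold r; lra).
  assert (Hzr : Cmod z < r) by (unfold r; lra).
  assert (Hr0 : 0 < r) by lra.
  assert (HB : ex_series (fun k => (INR k * (INR k * Cmod (c k))) * r ^ k)).
  { apply ex_series_CV_radius; [|lra|].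
    - intros k; repeat apply Rmult_le_pos; try apply pos_INR; apply Cmod_ge_0.
    - rewrite (CV_radius_mult_INR (fun k => INR k * Cmod (c k))), CV_radius_mult_INR.
      exact (pow_series_CV_radius c h r Hc Hr). }
  assert (HD : ex_series (fun k => (deriv_coef c k * z ^ k)%C)).
  { apply (ex_series_le (V := C_CompleteNormedModule) _
             (fun k => / r * (INR (S k) * (INR (S k) * Cmod (c (S k))) * r ^ S k))).
    2: { refine (ex_series_scal_l (/ r) (fun k => INR (S k) * (INR (S k) * Cmod (c (S k))) * r ^ S k) _).
         apply (ex_series_incr_1 (fun k => (INR k * (INR k * Cmod (c k))) * r ^ k)), HB. }
    intros k; change norm with Cmod; unfold deriv_coef.
    rewrite !Cmod_mult, Cmod_pow, Cmod_R, (Rabs_pos_eq _ (pos_INR _)).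
    replace (/ r * (INR (S k) * (INR (S k) * Cmod (c (S k))) * r ^ S k))
      with (INR (S k) * (INR (S k) * Cmod (c (S k)) * r ^ k)) by (simpl pow; field; lra).
    assert (1 <= INR (S k)) by (rewrite S_INR; generalize (pos_INR k); lra).
    apply Rle_trans with (INR (S k) * Cmod (c (S k)) * r ^ k).
    - apply Rmult_le_compat_l; [apply Rmult_le_pos; [lra|apply Cmod_ge_0]|].
      apply pow_incr; lra.
    - rewrite <- (Rmult_1_l (INR (S k) * Cmod (c (S k)) * r ^ k)) at 1.
      apply Rmult_le_compat_r; [|assumption].
      repeat apply Rmult_le_pos; [lra|apply Cmod_ge_0|apply pow_le; lra]. }
  destruct HD as [l Hl].
  destruct HB as [B HB].
  replace (C_derive h z) with l; [exact Hl|symmetry].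
  apply (C_lim_lipschitz _ z l (r - Cmod z) (B / r ^ 2)); [lra|].
  intros w Hwz Hw.
  assert (Hwr : Cmod w <= r).
  { replace w with ((w - z) + z)%C by ring.
    eapply Rle_trans; [apply Cmod_triangle|lra]. }
  assert (Hwz' : (w - z)%C <> 0) by (intros E; apply Hwz; replace w with ((w - z) + z)%C by ring; rewrite E; ring).
  assert (Hwz0 : 0 < Cmod (w - z)) by now apply Cmod_gt_0.
  replace ((h w - h z) / (w - z) - l)%C with ((h w - h z - l * (w - z)) / (w - z))%C
    by (field; exact Hwz').
  rewrite Cmod_div by exact Hwz'.
  apply (Rmult_le_reg_r (Cmod (w - z)) _ _ Hwz0).
  replace (Cmod (h w - h z - l * (w - z)) / Cmod (w - z) * Cmod (w - z))
    with (Cmod (h w - h z - l * (w - z))) by (field; lra).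
  (* Writing [pred k] keeps the formula valid at [k = 0], where the factor [INR 0] removes the
     derivative term. *)
  set (E := fun k => (c k * (w ^ k - z ^ k) - INR k * c k * z ^ pred k * (w - z))%C).
  assert (HE : is_series E (h w - h z - l * (w - z))%C).
  { apply is_series_Cext with (fun k => ((c k * w ^ k - c k * z ^ k) - (INR k * c k * z ^ pred k * (w - z)))%C).
    { intros k; unfold E; ring. }
    apply is_series_Cminus; [apply is_series_Cminus; apply Hc; unfold unit_disc; lra|].
    apply is_series_decr_1.
    change plus with Cplus; change opp with Copp.
    replace (l * (w - z) + - (INR 0 * c 0%nat * z ^ pred 0 * (w - z)))%C with ((w - z) * l)%C by (simpl; ring).
    apply is_series_Cext with (fun k => ((w - z) * (deriv_coef c k * z ^ k))%C).
    { intros k; unfold deriv_coef; simpl pred; ring. }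
    now apply is_series_Cscal. }
  apply (Cmod_series_le E (fun k => Cmod (w - z) ^ 2 / r ^ 2 * ((INR k * (INR k * Cmod (c k))) * r ^ k)) _ _ HE).
  { replace (B / r ^ 2 * Cmod (w - z) * Cmod (w - z)) with (Cmod (w - z) ^ 2 / r ^ 2 * B) by (field; lra).
    exact (is_series_scal_l (K := R_AbsRing) (Cmod (w - z) ^ 2 / r ^ 2) _ _ HB). }
  intros [|k]; unfold E.
  - replace (c 0%nat * (w ^ 0 - z ^ 0) - INR 0 * c 0%nat * z ^ pred 0 * (w - z))%C with (RtoC 0)
      by (simpl; ring).
    rewrite Cmod_0; simpl INR; lra.
  - replace (c (S k) * (w ^ S k - z ^ S k) - INR (S k) * c (S k) * z ^ pred (S k) * (w - z))%C
      with (c (S k) * (w ^ S k - z ^ S k - INR (S k) * z ^ k * (w - z)))%C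
      by (simpl pred; ring).
    rewrite Cmod_mult.
    eapply Rle_trans;
      [apply Rmult_le_compat_l; [apply Cmod_ge_0|exact (Cpow_remainder r w z k Hr0 Hwr (Rlt_le _ _ Hzr))]|].
    right; field; lra.
Qed.

(** * Operations on power series and removal of singularities *)

Lemma is_series_Cshift (a : nat -> C) (j : nat) (l : C) :
  (forall k, (k < j)%nat -> a k = 0) -> is_series a l ->
  is_series (fun k => a (j + k)%nat) l.
Proof.
  revert a; induction j as [|j IH]; intros a H0 Ha; [exact Ha|].
  apply (IH (fun k => a (S k))); [intros k Hk; apply H0; lia|].
  apply is_series_incr_1; change plus with Cplus.
  rewrite (H0 0%nat) by lia.
  replace (l + 0)%C with l by ring; exact Ha.
Qed.

Lemma is_series_Cunshift (a : nat -> C) (j : nat) (l : C) :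
  (forall k, (k < j)%nat -> a k = 0) -> is_series (fun k => a (j + k)%nat) l ->
  is_series a l.
Proof.
  revert a; induction j as [|j IH]; intros a H0 Ha; [exact Ha|].
  apply is_series_decr_1; change plus with Cplus; change opp with Copp.
  rewrite (H0 0%nat) by lia.
  replace (l + - 0)%C with l by ring.
  apply IH; [intros k Hk; apply H0; lia|exact Ha].
Qed.

Lemma pow_series_ext (c c' : nat -> C) (h : C -> C) :
  (forall k, c k = c' k) -> pow_series c h -> pow_series c' h.
Proof.
  intros E H z Hz; apply is_series_Cext with (2 := H z Hz).
  now intros k; rewrite E.
Qed.

Lemma pow_series_scal (s : C) (c : nat -> C) (h : C -> C) :
  pow_series c h -> pow_series (fun k => (s * c k)%C) (fun z => (s * h z)%C).
Proof.
  intros H z Hz; apply is_series_Cext with (fun k => (s * (c k * z ^ k))%C).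
  - intros k; ring.
  - now apply is_series_Cscal, H.
Qed.

Lemma pow_series_plus (c c' : nat -> C) (h h' : C -> C) :
  pow_series c h -> pow_series c' h' ->
  pow_series (fun k => (c k + c' k)%C) (fun z => (h z + h' z)%C).
Proof.
  intros H H' z Hz; apply is_series_Cext with (fun k => (c k * z ^ k + c' k * z ^ k)%C).
  - intros k; ring.
  - apply is_series_Cplus; [now apply H|now apply H'].
Qed.

Lemma pow_series_minus (c c' : nat -> C) (h h' : C -> C) :
  pow_series c h -> pow_series c' h' ->
  pow_series (fun k => (c k - c' k)%C) (fun z => (h z - h' z)%C).
Proof.
  intros H H' z Hz; apply is_series_Cext with (fun k => (c k * z ^ k - c' k * z ^ k)%C).
  - intros k; ring.
  - apply is_series_Cminus; [now apply H|now apply H'].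
Qed.

(** Differentiation lowers each exponent by one and the factor [z] restores it; the index 0 left
    free carries the coefficient 0. This operator is diagonal on monomials, which makes it easy to
    iterate. *)
Lemma pow_series_euler (c : nat -> C) (h : C -> C) :
  pow_series c h ->
  pow_series (fun k => (INR k * c k)%C) (fun z => (z * C_derive h z)%C).
Proof.
  intros H z Hz.
  apply (is_series_Cunshift _ 1).
  - intros k Hk; replace k with 0%nat by lia; simpl; ring.
  - apply is_series_Cext with (fun k => (z * (deriv_coef c k * z ^ k))%C).
    + intros k; unfold deriv_coef; change (1 + k)%nat with (S k); rewrite Cpow_S; ring.
    + now apply is_series_Cscal, pow_series_C_derive.
Qed.

Lemma pow_series_at_0 (c : nat -> C) (h : C -> C) : pow_series c h -> h 0 = c 0%nat.
Proof.
  intros H.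
  assert (D0 : unit_disc 0) by (unfold unit_disc; rewrite Cmod_0; lra).
  apply (is_series_C_unique _ _ _ (H 0 D0)).
  apply is_series_decr_1; change plus with Cplus; change opp with Copp.
  (* At 0 the tail agrees with 0 times the whole series, so it sums to [0 * h 0] without a separate
     convergence argument. *)
  replace (c 0%nat + - (c 0%nat * 0 ^ 0))%C with (0 * h 0)%C by (simpl; ring).
  apply is_series_Cext with (fun k => (0 * (c k * 0 ^ k))%C).
  - intros k; rewrite Cpow_S; ring.
  - now apply is_series_Cscal, H.
Qed.

Lemma pow_series_const (v : C) :
  pow_series (fun k => match k with O => v | S _ => RtoC 0 end) (fun _ => v).
Proof.
  intros z _; apply is_series_decr_1; change plus with Cplus; change opp with Copp.
  replace (v + - (v * z ^ 0))%C with (RtoC 0) by (simpl; ring).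
  (* The zero tail is dominated by a null geometric series, which yields some sum [l]; scaling by 0
     then identifies the sum as 0. *)
  assert (HR : is_series (fun k => 0 * (/ 2) ^ k) (0 * / (1 - / 2))).
  { refine (is_series_scal_l (K := R_AbsRing) 0 (fun k => (/ 2) ^ k) _ _).
    apply is_series_geom; rewrite Rabs_pos_eq; lra. }
  destruct (ex_series_le (V := C_CompleteNormedModule) (fun k => (0 * z ^ S k)%C) (fun k => 0 * (/ 2) ^ k)) as [l Hl].
  - intros k; change norm with Cmod; rewrite Cmod_mult, Cmod_0; lra.
  - now eexists; exact HR.
  - replace (RtoC 0) with (0 * l)%C by ring.
    apply is_series_Cext with (2 := is_series_Cscal 0 _ _ Hl).
    intros k; ring.
Qed.

(** For [Cmod w < / 2], the power [Cmod w ^ S k] is at most [2 * Cmod w * (/ 2) ^ S k], so the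
    absolute sum at 1/2 without its constant term, doubled, is a Lipschitz constant at 0. *)
Lemma pow_series_0_lipschitz (c : nat -> C) (h : C -> C) :
  pow_series c h ->
  exists K, forall w, Cmod w < / 2 -> Cmod (h w - c 0%nat) <= K * Cmod w.
Proof.
  intros H.
  assert (Hhalf : 0 <= / 2 < 1) by lra.
  destruct (ex_series_CV_radius (fun k => Cmod (c k)) (/ 2)) as [K0 HK];
    [intros; apply Cmod_ge_0|lra|exact (pow_series_CV_radius c h _ H Hhalf)|].
  set (K := K0 : R) in *; exists (2 * (K - Cmod (c 0%nat))); intros w Hw.
  assert (Dw : unit_disc w) by (unfold unit_disc; lra).
  apply (Cmod_series_le (fun k => (c (S k) * w ^ S k)%C)
           (fun k => 2 * Cmod w * (Cmod (c (S k)) * (/ 2) ^ S k))).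
  - apply (is_series_incr_1 (fun k => (c k * w ^ k)%C)); change plus with Cplus.
    replace (h w - c 0%nat + c 0%nat * w ^ 0)%C with (h w) by (simpl; ring).
    now apply H.
  - replace (2 * (K - Cmod (c 0%nat)) * Cmod w)
      with (2 * Cmod w * (K - Cmod (c 0%nat))) by ring.
    refine (is_series_scal_l (K := R_AbsRing) (2 * Cmod w)
              (fun k => Cmod (c (S k)) * (/ 2) ^ S k) _ _).
    apply (is_series_incr_1 (fun k => Cmod (c k) * (/ 2) ^ k)).
    change plus with Rplus.
    assert (E : K - Cmod (c 0%nat) + Cmod (c 0%nat) * (/ 2) ^ 0 = K) by (simpl pow; lra).
    rewrite E; exact HK.
  - intros k; rewrite Cmod_mult, Cmod_pow; simpl pow.
    replace (2 * Cmod w * (Cmod (c (S k)) * (/ 2 * (/ 2) ^ k)))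
      with (Cmod (c (S k)) * (Cmod w * (/ 2) ^ k)) by field.
    apply Rmult_le_compat_l; [apply Cmod_ge_0|].
    apply Rmult_le_compat_l; [apply Cmod_ge_0|].
    apply pow_incr; split; [apply Cmod_ge_0|lra].
Qed.

Lemma pow_series_quot_pow (c : nat -> C) (h : C -> C) (j : nat) :
  (forall k, (k < j)%nat -> c k = 0) -> pow_series c h ->
  pow_series (fun k => c (j + k)%nat) (quot_pow h j).
Proof.
  intros H0 H.
  assert (Hnz : forall w, unit_disc w -> w <> 0 ->
            is_series (fun k => (c (j + k)%nat * w ^ k)%C) (h w / w ^ j)%C).
  { intros w Dw Hw.
    assert (Hwj : (w ^ j)%C <> 0) by now apply Cpow_nz.
    replace (h w / w ^ j)%C with (/ w ^ j * h w)%C by (field; exact Hwj).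
    apply is_series_Cext with (fun k => (/ w ^ j * (c (j + k)%nat * w ^ (j + k)))%C).
    - intros k; rewrite Cpow_add_r; field; exact Hwj.
    - apply is_series_Cscal, (is_series_Cshift (fun k => (c k * w ^ k)%C)).
      + intros k Hk; rewrite H0 by exact Hk; ring.
      + now apply H. }
  (* [g] puts the expected value [c j] at 0 by hand. Being a power series, it is Lipschitz at 0, and
     this identifies the limit in [quot_pow] with [c j]. *)
  set (g := fun w => if Ceq_dec w 0 then c j else (h w / w ^ j)%C).
  assert (Hg : pow_series (fun k => c (j + k)%nat) g).
  { intros w Dw; unfold g; destruct (Ceq_dec w 0) as [->|Hw]; [|now apply Hnz].
    apply is_series_Cext with (fun k => (match k with O => c j | S _ => 0 end * 0 ^ k)%C).
    - intros [|k]; [now rewrite Nat.add_0_r|rewrite Cpow_S; ring].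
    - exact (pow_series_const (c j) 0 Dw). }
  intros z Dz.
  replace (quot_pow h j z) with (g z); [now apply Hg|].
  unfold g, quot_pow; destruct (Ceq_dec z 0) as [_|_]; [|reflexivity].
  destruct (pow_series_0_lipschitz _ _ Hg) as [K HK].
  symmetry; apply (C_lim_lipschitz _ 0 _ (/ 2) K); [lra|].
  intros w Hw Hwr.
  replace (w - 0)%C with w in * by ring.
  specialize (HK w Hwr); rewrite Nat.add_0_r in HK.
  unfold g in HK; destruct (Ceq_dec w 0); [contradiction|exact HK].
Qed.

(** * Expansion of [calF] *)

(** Together with [pow_series c h] this says that [h(z) = v z^e + O(z^(n+e))] at 0. *)
Definition gap (n e : nat) (v : C) (c : nat -> C) : Prop :=
  c e = v /\ forall k, (k < n + e)%nat -> k <> e -> c k = 0.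

Lemma pow_series_C_derive_n (c : nat -> C) (f : C -> C) (m : nat) :
  pow_series c f -> pow_series (Nat.iter m deriv_coef c) (C_derive_n f m).
Proof.
  intros H; induction m as [|m IH]; [exact H|].
  now apply pow_series_C_derive.
Qed.

Lemma gap_deriv_coef (n e : nat) (v : C) (c : nat -> C) :
  gap n (S e) v c -> gap n e (INR (S e) * v)%C (deriv_coef c).
Proof.
  intros [He H]; split; unfold deriv_coef.
  - now rewrite He.
  - intros k Hk Hke; rewrite H by lia; ring.
Qed.

Lemma gap_iter_deriv_coef (n m e : nat) (c : nat -> C) :
  gap n (m + e) 1 c ->
  gap n e (INR (fact (m + e)) / INR (fact e))%C (Nat.iter m deriv_coef c).
Proof.
  intros H.
  (* The induction runs over the number [i] of derivatives taken, with [d] the current leading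
     exponent and [i + d] fixed; one more derivative turns [1 / (d+1)!] into [1 / d!]. *)
  assert (Hgen : forall i d, (i + d = m + e)%nat ->
            gap n d (INR (fact (m + e)) / INR (fact d))%C (Nat.iter i deriv_coef c)).
  { assert (Hf : forall d, RtoC (INR (fact d)) <> 0)
      by (intros d E; apply (INR_fact_neq_0 d); now apply RtoC_inj).
    induction i as [|i IH]; intros d Hd.
    - simpl in Hd; subst d; simpl Nat.iter.
      replace (INR (fact (m + e)) / INR (fact (m + e)))%C with (RtoC 1) by (field; apply Hf).
      exact H.
    - assert (HS : RtoC (INR (S d)) <> 0)
        by (intros E; apply (not_0_INR (S d)); [lia|now apply RtoC_inj]).
      replace (INR (fact (m + e)) / INR (fact d))%C
        with (INR (S d) * (INR (fact (m + e)) / INR (fact (S d))))%C.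
      + apply gap_deriv_coef, IH; lia.
      + rewrite fact_simpl, mult_INR, RtoC_mult; field; split; [apply Hf|exact HS]. }
  apply Hgen; reflexivity.
Qed.

(** Each application multiplies the [k]-th coefficient by [k / (p - m)]. This factor is 1 at the
    leading exponent [p - m], and zero coefficients stay zero. *)
Lemma salagean_n_expansion (n p m Om : nat) (v : C) (c : nat -> C) (h : C -> C) :
  (m < p)%nat -> pow_series c h -> gap n (p - m) v c ->
  exists c', pow_series c' (salagean_n p m Om h) /\ gap n (p - m) v c'.
Proof.
  intros Hmp Hh Hc.
  assert (Hq : RtoC (INR (p - m)) <> 0)
    by (intros E; apply (not_0_INR (p - m)); [lia|now apply RtoC_inj]).
  induction Om as [|Om [c' [Hs [Hv H0]]]]; [now exists c|].
  exists (fun k => (/ INR (p - m) * (INR k * c' k))%C); split.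
  - intros z Hz; simpl salagean_n; unfold salagean.
    replace (z / INR (p - m) * C_derive (salagean_n p m Om h) z)%C
      with (/ INR (p - m) * (z * C_derive (salagean_n p m Om h) z))%C by (field; exact Hq).
    exact (pow_series_scal _ _ _ (pow_series_euler _ _ Hs) z Hz).
  - split; [rewrite Hv; field; exact Hq|].
    intros k Hk Hkq; rewrite H0 by assumption; ring.
Qed.

Lemma pow_series_monomial (p : nat) :
  pow_series (fun k => if Nat.eq_dec k p then RtoC 1 else RtoC 0) (fun z => (z ^ p)%C).
Proof.
  intros z Hz; apply (is_series_Cunshift _ p).
  - intros k Hk; destruct (Nat.eq_dec k p); [lia|ring].
  - replace (z ^ p)%C with (z ^ p * 1)%C by ring.
    apply is_series_Cext with (2 := is_series_Cscal (z ^ p) _ _ (pow_series_const 1 z Hz)).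
    intros [|k]; destruct (Nat.eq_dec _ p); try lia.
    + rewrite Nat.add_0_r; simpl; ring.
    + ring.
Qed.

Lemma has_expansion_pow_series (n p : nat) (a : nat -> C) (f : C -> C) :
  (1 <= n)%nat -> has_expansion n p a f -> exists c, pow_series c f /\ gap n p 1 c.
Proof.
  intros Hn Ha.
  (* The expansion says nothing about [a] below [n + p], so those values are overwritten by 0 before
     the monomial [z ^ p] is added. *)
  exists (fun k => ((if lt_dec k (n + p) then RtoC 0 else a k)
                    + (if Nat.eq_dec k p then RtoC 1 else RtoC 0))%C); split.
  - intros z Hz.
    replace (f z) with ((f z - z ^ p) + z ^ p)%C by ring.
    refine (pow_series_plus (fun k => if lt_dec k (n + p) then RtoC 0 else a k) _
              (fun z => f z - z ^ p)%C _ _ (pow_series_monomial p) z Hz).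
    clear z Hz; intros z Hz; apply (is_series_Cunshift _ (n + p)).
    + intros k Hk; destruct (lt_dec k (n + p)); [ring|lia].
    + apply is_series_Cext with (2 := Ha z Hz); intros k.
      replace (n + p + k)%nat with (n + k + p)%nat by lia.
      destruct (lt_dec (n + k + p) (n + p)); [lia|reflexivity].
  - split.
    + destruct (lt_dec p (n + p)), (Nat.eq_dec p p); try lia; ring.
    + intros k Hk Hkp; destruct (lt_dec k (n + p)), (Nat.eq_dec k p); try lia; ring.
Qed.

(** The last operator multiplies the [k]-th coefficient by [1 - lam + lam k / (p - m)], again 1 at
    [k = p - m]; the leading value thus comes from the [m] derivatives alone. *)
Lemma calF_expansion (n p m Om : nat) (lam : R) (a : nat -> C) (f : C -> C) :
  (1 <= n)%nat -> (m < p)%nat -> has_expansion n p a f ->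
  exists c, pow_series c (calF p m Om lam f) /\
            gap n (p - m) (INR (fact p) / INR (fact (p - m)))%C c.
Proof.
  intros Hn Hmp Ha.
  destruct (has_expansion_pow_series n p a f Hn Ha) as [c [Hc Hgap]].
  replace p with (m + (p - m))%nat in Hgap by lia.
  apply gap_iter_deriv_coef in Hgap.
  replace (m + (p - m))%nat with p in Hgap by lia.
  destruct (salagean_n_expansion n p m Om _ _ _ Hmp (pow_series_C_derive_n c f m Hc) Hgap)
    as [s [Hs [Hv H0]]].
  assert (Hq : RtoC (INR (p - m)) <> 0)
    by (intros E; apply (not_0_INR (p - m)); [lia|now apply RtoC_inj]).
  exists (fun k => ((1 - lam) * s k + lam / INR (p - m) * (INR k * s k))%C); split.
  - intros z Hz; unfold calF.
    replace (lam * z / INR (p - m) * C_derive (salagean_n p m Om (C_derive_n f m)) z)%C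
      with (lam / INR (p - m) * (z * C_derive (salagean_n p m Om (C_derive_n f m)) z))%C
      by (field; exact Hq).
    exact (pow_series_plus _ _ _ _ (pow_series_scal (1 - lam) _ _ Hs)
             (pow_series_scal (lam / INR (p - m)) _ _ (pow_series_euler _ _ Hs)) z Hz).
  - split.
    + rewrite Hv; field; split; [|exact Hq].
      intros E; apply (INR_fact_neq_0 (p - m)); now apply RtoC_inj.
    + intros k Hk Hkq; rewrite H0 by assumption; ring.
Qed.

(** * Maximum modulus principle *)

(** As with [sum_n], the bound is inclusive: there are [n + 1] terms. *)
Definition Csum (f : nat -> C) (n : nat) : C := sum_n f n.

Lemma Csum_0 (f : nat -> C) : Csum f 0 = f 0%nat.
Proof. exact (sum_O f). Qed.

Lemma Csum_S (f : nat -> C) (n : nat) : Csum f (S n) = (Csum f n + f (S n))%C.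
Proof. exact (sum_Sn f n). Qed.

Lemma Csum_ext (f g : nat -> C) (n : nat) :
  (forall k, (k <= n)%nat -> f k = g k) -> Csum f n = Csum g n.
Proof. exact (sum_n_ext_loc f g n). Qed.

Lemma Csum_plus (f g : nat -> C) (n : nat) :
  Csum (fun k => (f k + g k)%C) n = (Csum f n + Csum g n)%C.
Proof. exact (sum_n_plus f g n). Qed.

Lemma Csum_scal (s : C) (f : nat -> C) (n : nat) :
  Csum (fun k => (s * f k)%C) n = (s * Csum f n)%C.
Proof. exact (sum_n_mult_l s f n). Qed.

Lemma Cmod_Csum_le (f : nat -> C) (b : nat -> R) (n : nat) :
  (forall k, Cmod (f k) <= b k) -> Cmod (Csum f n) <= sum_n b n.
Proof.
  intros H; eapply Rle_trans; [exact (norm_sum_n_m f 0 n)|].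
  apply sum_n_m_le, H.
Qed.

Lemma Csum_delta (a : nat -> C) (k n : nat) :
  Csum (fun j => if Nat.eq_dec j k then a j else RtoC 0) n
  = if le_dec k n then a k else RtoC 0.
Proof.
  induction n as [|n IH].
  - rewrite Csum_0; destruct (Nat.eq_dec 0 k) as [E|], (le_dec k 0); try lia;
      try rewrite E; reflexivity.
  - rewrite Csum_S, IH.
    destruct (le_dec k n), (Nat.eq_dec (S n) k) as [E|], (le_dec k (S n)); try lia;
      try rewrite E; ring.
Qed.

Lemma Csum_geom (x : C) (n : nat) :
  ((x - 1) * Csum (fun k => x ^ k) n)%C = (x ^ S n - 1)%C.
Proof.
  induction n as [|n IH].
  - rewrite Csum_0; simpl; ring.
  - rewrite Csum_S.
    replace ((x - 1) * (Csum (fun k => x ^ k) n + x ^ S n))%C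
      with ((x - 1) * Csum (fun k => x ^ k) n + (x - 1) * x ^ S n)%C by ring.
    rewrite IH, (Cpow_S x (S n)); ring.
Qed.

Lemma sum_n_geom_le (x : R) (n : nat) :
  0 <= x < 1 -> sum_n (fun k => x ^ k) n <= / (1 - x).
Proof.
  intros Hx.
  assert (E : (1 - x) * sum_n (fun k => x ^ k) n = 1 - x ^ S n).
  { induction n as [|n IH].
    - rewrite sum_O; simpl; lra.
    - rewrite sum_Sn; change plus with Rplus.
      rewrite Rmult_plus_distr_l, IH; simpl; ring. }
  apply (Rmult_le_reg_l (1 - x)); [lra|].
  rewrite E, Rinv_r by lra.
  generalize (pow_le x (S n) (proj1 Hx)); lra.
Qed.

(** * Roots of unity and extraction of coefficients *)

Lemma cis_plus (s t : R) : cis (s + t) = (cis s * cis t)%C.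
Proof.
  unfold cis; apply injective_projections; simpl; [rewrite cos_plus|rewrite sin_plus]; ring.
Qed.

Lemma cis_0 : cis 0 = 1.
Proof. unfold cis; now rewrite cos_0, sin_0. Qed.

Lemma cis_pow (t : R) (k : nat) : (cis t ^ k)%C = cis (INR k * t).
Proof.
  induction k as [|k IH].
  - simpl; now rewrite Rmult_0_l, cis_0.
  - rewrite Cpow_S, IH, <- cis_plus, S_INR; f_equal; ring.
Qed.

Lemma Cmod_cis (t : R) : Cmod (cis t) = 1.
Proof.
  unfold Cmod, cis; simpl fst; simpl snd.
  replace (cos t ^ 2 + sin t ^ 2) with 1; [apply sqrt_1|].
  generalize (sin2_cos2 t); unfold Rsqr; intros; lra.
Qed.

Lemma cis_nat_2PI (k : nat) : cis (INR k * (2 * PI)) = 1.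
Proof.
  rewrite <- cis_pow; unfold cis; rewrite cos_2PI, sin_2PI; apply Cpow_1_l.
Qed.

Lemma cis_inv (t : R) : (cis t * cis (- t))%C = 1.
Proof. rewrite <- cis_plus, Rplus_opp_r; apply cis_0. Qed.

(** From [1 - cos t = 2 sin^2 (t/2)], a value 1 would force [sin (t / 2) = 0], impossible for
    [0 < |t/2| < PI]. *)
Lemma cis_neq_1 (t : R) : t <> 0 -> Rabs t < 2 * PI -> cis t <> 1.
Proof.
  intros Ht0 Ht E.
  assert (Hc : cos t = 1) by exact (f_equal fst E).
  assert (Hs : sin (t / 2) * sin (t / 2) = 0).
  { replace t with (2 * (t / 2)) in Hc by field.
    rewrite cos_2a_sin in Hc; lra. }
  assert (Hs0 : sin (t / 2) = 0) by nra.
  apply Rabs_def2 in Ht.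
  destruct (Rdichotomy _ _ Ht0) as [Hn|Hp].
  - assert (0 < sin (- (t / 2))) by (apply sin_gt_0; lra).
    rewrite sin_neg in H; lra.
  - assert (0 < sin (t / 2)) by (apply sin_gt_0; lra).
    lra.
Qed.

(* The [j]-th Taylor coefficient of a polynomial of degree at most [N], read off its values at the
   [N+1]-st roots of unity. *)
Definition fourier_coef (N j : nat) (f : C -> C) : C :=
  (/ INR (S N) * Csum (fun l => f (cis (INR l * (2 * PI / INR (S N))))
                             * cis (- (INR j * (INR l * (2 * PI / INR (S N)))))) N)%C.

(** Orthogonality of characters: the summands are the powers of [x], an [N+1]-st root of unity. For
    [j <> k] it differs from 1 because [|k - j| <= N], so the geometric sum vanishes. *)
Lemma fourier_coef_monomial (N j k : nat) :
  (j <= N)%nat -> (k <= N)%nat ->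
  fourier_coef N j (fun w => (w ^ k)%C) = if Nat.eq_dec j k then RtoC 1 else RtoC 0.
Proof.
  intros Hj Hk; unfold fourier_coef.
  assert (HN : 0 < INR (S N)) by (apply lt_0_INR; lia).
  assert (HN' : RtoC (INR (S N)) <> 0) by (intros E; apply RtoC_inj in E; lra).
  set (t := 2 * PI / INR (S N)).
  set (x := cis ((INR k - INR j) * t)).
  rewrite (Csum_ext _ (fun l => x ^ l)%C).
  2: { intros l _; unfold x; rewrite !cis_pow, <- cis_plus; f_equal; ring. }
  destruct (Nat.eq_dec j k) as [<-|Hjk].
  - replace x with (RtoC 1) by (unfold x; rewrite Rminus_diag, Rmult_0_l, cis_0; reflexivity).
    replace (Csum (fun l => 1 ^ l)%C N) with (RtoC (INR (S N))); [field; exact HN'|].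
    clear; induction N as [|N IH].
    + rewrite Csum_0; simpl; ring.
    + rewrite Csum_S, <- IH, Cpow_1_l, (S_INR (S N)), RtoC_plus; reflexivity.
  - assert (Hx : x <> 1).
    { assert (HkR : INR k <= INR N) by now apply le_INR.
      assert (HjR : INR j <= INR N) by now apply le_INR.
      assert (Hkj : INR k - INR j <> 0) by (intros E; apply Hjk, INR_eq; lra).
      assert (Ht : 0 < t) by (apply Rdiv_lt_0_compat; [generalize PI_RGT_0; lra|exact HN]).
      assert (HtN : INR (S N) * t = 2 * PI) by (unfold t; field; lra).
      apply cis_neq_1.
      - apply Rmult_integral_contrapositive_currified; lra.
      - rewrite Rabs_mult, (Rabs_pos_eq t), <- HtN by lra.
        apply Rmult_lt_compat_r; [exact Ht|].
        rewrite S_INR; apply Rabs_def1; generalize (pos_INR k) (pos_INR j); lra. }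
    assert (Hx1 : (x - 1)%C <> 0)
      by (intros E; apply Hx; replace x with ((x - 1) + 1)%C by ring; rewrite E; ring).
    assert (HxN : (x ^ S N)%C = 1).
    { unfold x; rewrite cis_pow.
      replace (INR (S N) * ((INR k - INR j) * t))
        with (INR k * (2 * PI) + - (INR j * (2 * PI))) by (unfold t; field; lra).
      generalize (cis_inv (INR j * (2 * PI))).
      rewrite cis_plus, !cis_nat_2PI; trivial. }
    replace (Csum (fun l => x ^ l)%C N) with (RtoC 0); [ring|].
    generalize (Csum_geom x N); rewrite HxN; intros E.
    replace (Csum (fun l => x ^ l)%C N)
      with (/ (x - 1) * ((x - 1) * Csum (fun l => x ^ l)%C N))%C by (field; exact Hx1).
    rewrite E; ring.
Qed.

Lemma fourier_coef_scal_plus (N j : nat) (s : C) (f g : C -> C) :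
  fourier_coef N j (fun w => (s * f w + g w)%C)
  = (s * fourier_coef N j f + fourier_coef N j g)%C.
Proof.
  unfold fourier_coef.
  set (u := fun l : nat => cis (INR l * (2 * PI / INR (S N)))).
  set (v := fun l : nat => cis (- (INR j * (INR l * (2 * PI / INR (S N)))))).
  rewrite (Csum_ext _ (fun l => s * (f (u l) * v l) + g (u l) * v l)%C)
    by (intros l _; unfold u, v; ring).
  rewrite Csum_plus, Csum_scal; unfold u, v; ring.
Qed.

(** The coefficient is an average of [N + 1] values of [f] on the unit circle, each multiplied by a
    number of modulus 1. *)
Lemma Cmod_fourier_coef_le (N j : nat) (f : C -> C) (M : R) :
  (forall w, Cmod w = 1 -> Cmod (f w) <= M) -> Cmod (fourier_coef N j f) <= M.
Proof.
  intros H; unfold fourier_coef.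
  assert (HN : 0 < INR (S N)) by (apply lt_0_INR; lia).
  rewrite <- RtoC_inv, Cmod_mult, Cmod_R, Rabs_pos_eq
    by (try apply Rlt_le, Rinv_0_lt_compat; lra).
  apply (Rmult_le_reg_l (INR (S N)) _ _ HN).
  rewrite <- Rmult_assoc, Rinv_r, Rmult_1_l by lra.
  rewrite <- sum_n_const.
  apply Cmod_Csum_le; intros l.
  rewrite Cmod_mult, (Cmod_cis (- _)), Rmult_1_r; apply H, Cmod_cis.
Qed.

(** * Polynomials on the unit disc *)

Fixpoint horner (l : list C) (z : C) : C :=
  match l with
  | [] => 0
  | c :: l' => c + z * horner l' z
  end.

Definition polynomial (f : C -> C) : Prop := exists l, forall z, f z = horner l z.

Lemma polynomial_plus (f g : C -> C) :
  polynomial f -> polynomial g -> polynomial (fun z => (f z + g z)%C).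
Proof.
  intros [l Hl] [l' Hl'].
  assert (H : forall l l', exists r, forall z, horner r z = (horner l z + horner l' z)%C).
  { clear; induction l as [|c l IH]; intros l'.
    - exists l'; intros z; simpl; ring.
    - destruct l' as [|c' l'].
      + exists (c :: l); intros z; simpl; ring.
      + destruct (IH l') as [r Hr].
        exists ((c + c')%C :: r); intros z; simpl; rewrite Hr; ring. }
  destruct (H l l') as [r Hr]; exists r; intros z; now rewrite Hr, Hl, Hl'.
Qed.

Lemma polynomial_const (c : C) : polynomial (fun _ => c).
Proof. exists [c]; intros z; simpl; ring. Qed.

Lemma polynomial_mult_id (f : C -> C) : polynomial f -> polynomial (fun z => (z * f z)%C).
Proof. intros [l Hl]; exists (RtoC 0 :: l); intros z; simpl; rewrite Hl; ring. Qed.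

Lemma polynomial_ext (f g : C -> C) : (forall z, f z = g z) -> polynomial f -> polynomial g.
Proof. intros E [l Hl]; exists l; intros z; now rewrite <- E. Qed.

Lemma polynomial_scal (s : C) (f : C -> C) : polynomial f -> polynomial (fun z => (s * f z)%C).
Proof.
  intros [l Hl]; exists (map (Cmult s) l); intros z; rewrite Hl; clear Hl.
  induction l as [|c l IH]; simpl; [ring|].
  rewrite <- IH; ring.
Qed.

Lemma polynomial_mult (f g : C -> C) :
  polynomial f -> polynomial g -> polynomial (fun z => (f z * g z)%C).
Proof.
  intros [l Hl] Hg.
  apply polynomial_ext with (fun z => (horner l z * g z)%C); [intros z; now rewrite Hl|].
  clear f Hl; induction l as [|c l IH].
  - apply polynomial_ext with (2 := polynomial_const 0); intros z; simpl; ring.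
  - apply polynomial_ext with (fun z => (c * g z + z * (horner l z * g z))%C).
    + intros z; simpl; ring.
    + apply polynomial_plus; [now apply polynomial_scal|now apply polynomial_mult_id].
Qed.

Lemma polynomial_pow (f : C -> C) (L : nat) :
  polynomial f -> polynomial (fun z => (f z ^ L)%C).
Proof.
  intros Hf; induction L as [|L IH]; [exact (polynomial_const 1)|].
  apply polynomial_ext with (fun z => (f z * f z ^ L)%C); [intros z; now rewrite Cpow_S|].
  now apply polynomial_mult.
Qed.

Lemma polynomial_monomial (c : C) (k : nat) : polynomial (fun z => (c * z ^ k)%C).
Proof.
  apply polynomial_scal, polynomial_pow.
  exists [RtoC 0; RtoC 1]; intros z; simpl; ring.
Qed.

Lemma polynomial_Csum (c : nat -> C) (n : nat) :
  polynomial (fun z => Csum (fun k => (c k * z ^ k)%C) n).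
Proof.
  induction n as [|n IH].
  - apply polynomial_ext with (2 := polynomial_monomial (c 0%nat) 0); intros z.
    now rewrite Csum_0.
  - apply polynomial_ext with (2 := polynomial_plus _ _ IH (polynomial_monomial (c (S n)) (S n))).
    intros z; now rewrite Csum_S.
Qed.

(** By linearity it is enough to recover monomials. The factor [z ^ k] carries the induction:
    splitting off the first coefficient leaves [c * z ^ k] and the same problem with [S k], the
    degree staying at most [N]. *)
Lemma horner_fourier (N k : nat) (l : list C) (z : C) :
  (k + length l <= S N)%nat ->
  (z ^ k * horner l z)%C
  = Csum (fun j => z ^ j * fourier_coef N j (fun w => w ^ k * horner l w))%C N.
Proof.
  revert k; induction l as [|c l IH]; intros k Hk.
  - simpl horner.
    rewrite (Csum_ext _ (fun j => 0 * 0)%C), Csum_scal; [ring|].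
    intros j _; unfold fourier_coef.
    rewrite (Csum_ext _ (fun j => 0 * 0)%C), Csum_scal; [ring|].
    intros i _; ring.
  - simpl in Hk.
    assert (E : forall w, (w ^ k * horner (c :: l) w)%C = (c * w ^ k + w ^ S k * horner l w)%C)
      by (intros w; rewrite Cpow_S; simpl horner; ring).
    rewrite E, IH by lia.
    rewrite (Csum_ext (fun j => z ^ j * fourier_coef N j (fun w => w ^ k * horner (c :: l) w))%C
               (fun j => c * (if Nat.eq_dec j k then z ^ j else 0)
                         + z ^ j * fourier_coef N j (fun w => w ^ S k * horner l w))%C).
    + rewrite Csum_plus, Csum_scal, (Csum_delta (fun j => z ^ j)%C).
      destruct (le_dec k N); [reflexivity|lia].
    + intros j Hj.
      replace (fourier_coef N j (fun w => w ^ k * horner (c :: l) w)%C)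
        with (fourier_coef N j (fun w => c * w ^ k + w ^ S k * horner l w)%C)
        by (unfold fourier_coef; f_equal; apply Csum_ext; intros i _; now rewrite E).
      rewrite fourier_coef_scal_plus, fourier_coef_monomial by lia.
      destruct (Nat.eq_dec j k); ring.
Qed.

(** Every Taylor coefficient is at most [M] in modulus, so the geometric series bounds the value. *)
Lemma polynomial_weak_bound (f : C -> C) (M : R) (z : C) :
  polynomial f -> (forall w, Cmod w = 1 -> Cmod (f w) <= M) -> unit_disc z ->
  Cmod (f z) <= M / (1 - Cmod z).
Proof.
  intros [l Hl] HM Hz; unfold unit_disc in Hz.
  assert (HM0 : 0 <= M)
    by (eapply Rle_trans; [apply Cmod_ge_0|apply (HM 1), Cmod_1]).
  rewrite Hl.
  replace (horner l z) with (z ^ 0 * horner l z)%C by (simpl; ring).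
  rewrite (horner_fourier (length l)) by lia.
  apply Rle_trans with (sum_n (fun j => M * Cmod z ^ j) (length l)).
  - apply Cmod_Csum_le; intros j.
    rewrite Cmod_mult, Cmod_pow, Rmult_comm.
    apply Rmult_le_compat_r; [apply pow_le, Cmod_ge_0|].
    apply Cmod_fourier_coef_le; intros w Hw.
    simpl Cpow; rewrite Cmult_1_l, <- Hl; now apply HM.
  - rewrite (sum_n_mult_l (K := R_Ring) M (fun j => Cmod z ^ j)).
    apply Rmult_le_compat_l; [exact HM0|].
    apply sum_n_geom_le; split; [apply Cmod_ge_0|exact Hz].
Qed.

(** If [x > y > 0], the powers of [x / y] eventually exceed [K + 1]; the case [y = 0] is settled by
    [L = 1]. *)
Lemma le_of_pow_le (x y K : R) :
  0 <= x -> 0 <= y -> (forall L, x ^ L <= K * y ^ L) -> x <= y.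
Proof.
  intros Hx Hy H.
  destruct (Rle_lt_dec x y) as [|Hlt]; [assumption|exfalso].
  destruct (Rle_lt_or_eq_dec _ _ Hy) as [Hy0| <-].
  2: { generalize (H 1%nat); simpl; lra. }
  destruct (Pow_x_infinity (x / y)) with (b := K + 1) as [L HL].
  { rewrite Rabs_pos_eq by (apply Rlt_le, Rdiv_lt_0_compat; lra).
    apply (Rmult_lt_reg_r y); [exact Hy0|]; unfold Rdiv; rewrite Rmult_assoc, Rinv_l; lra. }
  specialize (HL L (Nat.le_refl L)); specialize (H L).
  rewrite Rabs_pos_eq in HL by (apply pow_le, Rlt_le, Rdiv_lt_0_compat; lra).
  assert (HyL : 0 < y ^ L) by now apply pow_lt.
  assert (E : x ^ L = (x / y) ^ L * y ^ L).
  { rewrite <- Rpow_mult_distr; f_equal; field; lra. }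
  rewrite E in H; apply Rmult_le_reg_r in H; lra.
Qed.

(* Landau's trick: the constant in the weak bound disappears when it is applied to high powers. *)
Lemma polynomial_max_modulus (f : C -> C) (M : R) (z : C) :
  polynomial f -> (forall w, Cmod w = 1 -> Cmod (f w) <= M) -> unit_disc z ->
  Cmod (f z) <= M.
Proof.
  intros Hf HM Hz.
  apply le_of_pow_le with (/ (1 - Cmod z)).
  - apply Cmod_ge_0.
  - eapply Rle_trans; [apply Cmod_ge_0|apply (HM 1), Cmod_1].
  - intros L; rewrite <- Cmod_pow, Rmult_comm.
    apply (polynomial_weak_bound (fun w => (f w ^ L)%C)); [now apply polynomial_pow| |exact Hz].
    intros w Hw; rewrite Cmod_pow; apply pow_incr; split; [apply Cmod_ge_0|now apply HM].
Qed.

(** * Maximum modulus and Schwarz's lemma for power series *)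

(** Absolute convergence at [r] makes the truncation error at most [eps / 2] uniformly for
    [Cmod w <= r]. The error enters twice, once on the circle and once at [z]. *)
Lemma pow_series_max_modulus (c : nat -> C) (h : C -> C) (r M : R) (z : C) :
  pow_series c h -> r < 1 -> (forall w, Cmod w = r -> Cmod (h w) <= M) ->
  Cmod z < r -> Cmod (h z) <= M.
Proof.
  intros Hc Hr1 HM Hz.
  assert (Hr : 0 < r) by (generalize (Cmod_ge_0 z); lra).
  destruct (ex_series_CV_radius (fun k => Cmod (c k)) r) as [S0 HS];
    [intros; apply Cmod_ge_0|lra|
     apply (pow_series_CV_radius c h r Hc); lra|].
  apply le_epsilon; intros eps Heps.
  assert (Heps2 : 0 < eps / 2) by lra.
  destruct (proj1 (filterlim_locally _ _) HS (mkposreal _ Heps2)) as [N HN].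
  specialize (HN N (Nat.le_refl N)).
  assert (Htail : forall w, Cmod w <= r ->
            Cmod (h w - Csum (fun k => c k * w ^ k)%C N) <= eps / 2).
  { intros w Hw.
    apply Rle_trans with (S0 - sum_n (fun k => Cmod (c k) * r ^ k) N).
    2: { change (Rabs (minus (sum_n (fun k => Cmod (c k) * r ^ k) N) S0) < eps / 2) in HN.
         apply Rabs_def2 in HN; destruct HN as [_ HN].
         unfold minus in HN; change plus with Rplus in HN; change opp with Ropp in HN; lra. }
    apply (Cmod_series_le (fun k => c (S N + k)%nat * w ^ (S N + k))%C
             (fun k => Cmod (c (S N + k)%nat) * r ^ (S N + k))).
    - apply (is_series_incr_n (fun k => c k * w ^ k)%C); [lia|]; change plus with Cplus.
      change (sum_n (fun k => c k * w ^ k)%C (Init.Nat.pred (S N)))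
        with (Csum (fun k => c k * w ^ k)%C N).
      replace (h w - Csum (fun k => c k * w ^ k)%C N + Csum (fun k => c k * w ^ k)%C N)%C
        with (h w) by ring.
      apply Hc; unfold unit_disc; lra.
    - apply (is_series_incr_n (fun k => Cmod (c k) * r ^ k)); [lia|]; change plus with Rplus.
      simpl Init.Nat.pred.
      unfold Rminus; rewrite Rplus_assoc, Rplus_opp_l, Rplus_0_r; exact HS.
    - intros k; rewrite Cmod_mult, Cmod_pow.
      apply Rmult_le_compat_l; [apply Cmod_ge_0|].
      apply pow_incr; split; [apply Cmod_ge_0|exact Hw]. }
  assert (Hpoly : Cmod (Csum (fun k => c k * z ^ k)%C N) <= M + eps / 2).
  { assert (Hr' : RtoC r <> 0) by (intros E; apply RtoC_inj in E; lra).
    (* Rescaling by [r] moves the circle of radius [r] to the unit circle, where the polynomial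
       principle applies. *)
    assert (E : forall w, Csum (fun k => (c k * r ^ k) * (w / r) ^ k)%C N
                          = Csum (fun k => c k * w ^ k)%C N).
    { intros w; apply Csum_ext; intros k _.
      rewrite <- Cmult_assoc, <- Cpow_mult_l; do 2 f_equal; field; exact Hr'. }
    rewrite <- E.
    apply (polynomial_max_modulus (fun w => Csum (fun k => (c k * r ^ k) * w ^ k)%C N)).
    - apply polynomial_Csum.
    - intros w Hw.
      replace w with (w * r / r)%C by (field; exact Hr').
      assert (Hwr : Cmod (w * r) = r)
        by (rewrite Cmod_mult, Hw, Cmod_R, Rabs_pos_eq; lra).
      rewrite E.
      replace (Csum (fun k => c k * (w * r) ^ k)%C N)
        with (h (w * r)%C + - (h (w * r)%C - Csum (fun k => c k * (w * r) ^ k)%C N))%C by ring.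
      eapply Rle_trans; [apply Cmod_triangle|]; rewrite Cmod_opp.
      apply Rplus_le_compat; [now apply HM|apply Htail; lra].
    - unfold unit_disc; rewrite Cmod_div, Cmod_R, Rabs_pos_eq by (exact Hr' || lra).
      apply (Rmult_lt_reg_r r); [exact Hr|].
      unfold Rdiv; rewrite Rmult_assoc, Rinv_l; lra. }
  replace (h z) with ((h z - Csum (fun k => c k * z ^ k)%C N) + Csum (fun k => c k * z ^ k)%C N)%C
    by ring.
  eapply Rle_trans; [apply Cmod_triangle|].
  assert (Hzr : Cmod z <= r) by lra.
  generalize (Htail z Hzr); lra.
Qed.

(** On the circle of radius [r] the quotient is at most [M / r ^ n]; the maximum modulus principle
    carries this bound to [z], and [r] then tends to 1 from below. *)
Lemma schwarz (c : nat -> C) (h : C -> C) (n : nat) (M : R) :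
  pow_series c h -> (forall k, (k < n)%nat -> c k = 0) ->
  (forall z, unit_disc z -> Cmod (h z) <= M) ->
  forall z, unit_disc z -> Cmod (quot_pow h n z) <= M.
Proof.
  intros Hc H0 HM z Hz.
  assert (Hq := pow_series_quot_pow c h n H0 Hc).
  unfold unit_disc in Hz.
  assert (Hr : forall r, Cmod z < r < 1 -> r ^ n * Cmod (quot_pow h n z) <= M).
  { intros r Hr.
    assert (Hr0 : 0 < r) by (generalize (Cmod_ge_0 z); lra).
    assert (Hrn : 0 < r ^ n) by now apply pow_lt.
    apply (Rmult_le_reg_l (/ r ^ n)); [now apply Rinv_0_lt_compat|].
    rewrite <- Rmult_assoc, Rinv_l, Rmult_1_l by lra.
    apply (pow_series_max_modulus _ _ r _ _ Hq); [lra| |lra].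
    intros w Hw; unfold quot_pow.
    destruct (Ceq_dec w 0) as [->|Hw0]; [rewrite Cmod_0 in Hw; lra|].
    rewrite Cmod_div by now apply Cpow_nz.
    rewrite Cmod_pow, Hw, Rmult_comm.
    apply Rmult_le_compat_r; [now apply Rlt_le, Rinv_0_lt_compat|].
    apply HM; unfold unit_disc; lra. }
  replace (Cmod (quot_pow h n z)) with (1 ^ n * Cmod (quot_pow h n z)) by (rewrite pow1; ring).
  apply (filterlim_le (F := at_left 1) (fun r => r ^ n * Cmod (quot_pow h n z)) (fun _ => M)
           (Finite (1 ^ n * Cmod (quot_pow h n z))) (Finite M)).
  - assert (Hd : 0 < 1 - Cmod z) by lra.
    exists (mkposreal _ Hd); intros r Hball Hr1; apply Hr; split; [|exact Hr1].
    change (Rabs (r - 1) < 1 - Cmod z) in Hball; apply Rabs_def2 in Hball; lra.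
  - assert (Hcont : continuous (fun r : R => r ^ n * Cmod (quot_pow h n z)) 1)
      by (apply (ex_derive_continuous (K := R_AbsRing) (V := R_NormedModule)); auto_derive; trivial).
    exact (filterlim_filter_le_1 _ (filter_le_within _) Hcont).
  - apply filterlim_const.
Qed.

(** * The radial integral estimate *)

Lemma is_series_Re (a : nat -> C) (l : C) :
  is_series a l -> is_series (fun k => Re (a k)) (Re l).
Proof.
  intros Ha.
  assert (E : forall n, sum_n (fun k => Re (a k)) n = Re (Csum a n)).
  { induction n as [|n IH].
    - now rewrite Csum_0, sum_O.
    - rewrite Csum_S, sum_Sn, IH; reflexivity. }
  apply filterlim_locally; intros eps.
  destruct (proj1 (filterlim_locally _ _) Ha eps) as [N HN].
  exists N; intros n Hn.
  generalize (proj1 (HN n Hn)).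
  change (fst (sum_n a n)) with (Re (Csum a n)); rewrite <- E; trivial.
Qed.

(** The rotation by [Cconj x / Cmod x] turns a modulus into a real part, so that real calculus
    applies along a ray. *)
Lemma Cmod_as_Re (x : C) : exists u, Cmod u <= 1 /\ Re (u * x) = Cmod x.
Proof.
  destruct (Ceq_dec x 0) as [->|Hx].
  - exists (RtoC 0); rewrite Cmod_0; split; [lra|simpl; ring].
  - assert (H : 0 < Cmod x) by now apply Cmod_gt_0.
    assert (Hx' : RtoC (Cmod x) <> 0) by (intros E; apply RtoC_inj in E; lra).
    exists (/ Cmod x * Cconj x)%C; split.
    + rewrite Cmod_mult, Cmod_conj, <- RtoC_inv, Cmod_R, Rabs_pos_eq
        by (try apply Rlt_le, Rinv_0_lt_compat; lra).
      rewrite Rinv_l; lra.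
    + replace (/ Cmod x * Cconj x * x)%C with (/ Cmod x * (x * Cconj x))%C by ring.
      rewrite <- Cmod2_conj.
      replace (/ Cmod x * RtoC (Cmod x ^ 2))%C with (RtoC (Cmod x)); [reflexivity|].
      rewrite RtoC_pow; field; exact Hx'.
Qed.

(** The integral is replaced by monotonicity. With [phi(t) = Re (u * w (t z))], the relation between
    the coefficients reads [N phi + t phi' = Re (u * h (t z)) <= M], so [t^N (phi - M/N)] has
    nonpositive derivative on [[0,1]]; it vanishes at 0, hence is at most 0 at 1. *)
Lemma pow_series_integral_bound (d : nat -> C) (w h : C -> C) (N : nat) (M : R) :
  (1 <= N)%nat -> pow_series d w -> pow_series (fun k => (INR (k + N) * d k)%C) h ->
  (forall z, unit_disc z -> Cmod (h z) <= M) ->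
  forall z, unit_disc z -> Cmod (w z) <= M / INR N.
Proof.
  intros HN Hw Hh HM z Hz; unfold unit_disc in Hz.
  assert (Hz0 := Cmod_ge_0 z).
  destruct (Cmod_as_Re (w z)) as [u [Hu Huw]]; rewrite <- Huw.
  set (b := fun k => Re (u * (d k * z ^ k))).
  (* [rho] exceeds 1 while [Cmod z * rho] stays below 1, so the endpoint [t = 1] lies strictly
     inside the interval of convergence. *)
  assert (Hb : Rbar_lt 1 (CV_radius b)).
  { set (rho := 2 / (1 + Cmod z)).
    assert (Hrho : rho * (1 + Cmod z) = 2) by (unfold rho; field; lra).
    assert (Hrho1 : 1 < rho) by nra.
    assert (Hx : 0 <= Cmod z * rho < 1) by nra.
    destruct (ex_series_Cmod_bounded _ (ex_intro _ _ (Hw _ (RtoC_disc _ Hx)))) as [B HB].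
    apply Rbar_lt_le_trans with rho; [exact Hrho1|].
    apply CV_radius_ge with B; intros k.
    apply Rle_trans with (2 := HB k).
    rewrite Rabs_mult, Cmod_mult, Cmod_pow, Cmod_R, (Rabs_pos_eq (Cmod z * rho)), Rpow_mult_distr,
      (Rabs_pos_eq (rho ^ k)), <- Rmult_assoc by (try apply pow_le; lra).
    apply Rmult_le_compat_r; [apply pow_le; lra|].
    eapply Rle_trans; [apply re_le_Cmod|].
    rewrite !Cmod_mult, Cmod_pow.
    generalize (Rmult_le_pos _ _ (Cmod_ge_0 (d k)) (pow_le _ k Hz0)); nra. }
  assert (Hbt : forall t, 0 <= t <= 1 -> Rbar_lt (Rabs t) (CV_radius b)).
  { intros t Ht; apply Rbar_le_lt_trans with 1; [|exact Hb].
    rewrite Rabs_pos_eq; simpl; lra. }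
  assert (Dt : forall t, 0 <= t <= 1 -> unit_disc (t * z)).
  { intros t Ht; unfold unit_disc; rewrite Cmod_mult, Cmod_R, Rabs_pos_eq; nra. }
  (* The weight [e] is 1 for [w] and [INR (k + N)] for [h]; both series along the ray share the real
     coefficients [b]. *)
  assert (Hray : forall (e : nat -> R) (g : C -> C) t, 0 <= t <= 1 ->
            pow_series (fun k => (e k * d k)%C) g ->
            is_series (fun k => e k * (b k * t ^ k)) (Re (u * g (t * z)%C))).
  { intros e g t Ht Hg.
    apply is_series_ext with (fun k => Re (u * ((e k * d k) * (t * z) ^ k))).
    - intros k; unfold b.
      replace (u * ((e k * d k) * (t * z) ^ k))%C
        with (RtoC (e k * t ^ k) * (u * (d k * z ^ k)))%C
        by (rewrite Cpow_mult_l, RtoC_mult, RtoC_pow; ring).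
      generalize (u * (d k * z ^ k))%C; intros [x y]; simpl.
      match goal with |- ?l = ?r => change (@eq R l r) end; ring.
    - apply is_series_Re, is_series_Cscal, Hg, Dt, Ht. }
  assert (Hphi : forall t, 0 <= t <= 1 -> is_series (fun k => b k * t ^ k) (PSeries b t)).
  { intros t Ht; apply is_pseries_R, PSeries_correct, CV_radius_inside, Hbt, Ht. }
  assert (Hphi1 : PSeries b 1 = Re (u * w z)).
  { apply is_series_unique.
    assert (H1 : 0 <= 1 <= 1) by lra.
    assert (Hw1 : pow_series (fun k => (RtoC 1 * d k)%C) w)
      by (apply pow_series_ext with (2 := Hw); intros k; ring).
    generalize (Hray (fun _ => 1) w 1 H1 Hw1); rewrite Cmult_1_l.
    apply is_series_ext; intros k; apply Rmult_1_l. }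
  set (dphi := PSeries (PS_derive b)).
  assert (Hdphi : forall t, 0 <= t <= 1 -> is_series (fun k => INR k * (b k * t ^ k)) (t * dphi t)).
  { intros t Ht; apply is_series_decr_1.
    match goal with |- is_series _ ?l => replace l with (t * dphi t) end.
    2: { change (t * dphi t = t * dphi t + - (INR 0 * (b 0%nat * t ^ 0))); simpl; ring. }
    apply is_series_ext with (fun k => t * (PS_derive b k * t ^ k)).
    - intros k; unfold PS_derive.
      change (t * (INR (S k) * b (S k) * t ^ k) = INR (S k) * (b (S k) * (t * t ^ k))); ring.
    - refine (is_series_scal_l (K := R_AbsRing) t (fun k => PS_derive b k * t ^ k) _ _).
      apply is_pseries_R, PSeries_correct, ex_pseries_derive, Hbt, Ht. }
  assert (Heuler : forall t, 0 <= t <= 1 -> INR N * PSeries b t + t * dphi t <= M).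
  { intros t Ht.
    replace (INR N * PSeries b t + t * dphi t) with (Re (u * h (t * z)%C)).
    - eapply Rle_trans; [apply Rle_abs|].
      eapply Rle_trans; [apply re_le_Cmod|].
      rewrite Cmod_mult.
      assert (Hht := HM _ (Dt t Ht)).
      generalize (Cmod_ge_0 u) (Cmod_ge_0 (h (t * z)%C)); nra.
    - rewrite <- (is_series_unique _ _ (Hray (fun k => INR (k + N)) h t Ht Hh)).
      apply is_series_unique.
      apply is_series_ext with (fun k => plus (INR N * (b k * t ^ k)) (INR k * (b k * t ^ k))).
      + intros k; rewrite plus_INR.
        change (INR N * (b k * t ^ k) + INR k * (b k * t ^ k) = (INR k + INR N) * (b k * t ^ k)).
        ring.
      + refine (is_series_plus _ _ _ _ _ (Hdphi t Ht)).
        exact (is_series_scal_l (K := R_AbsRing) (INR N) (fun k => b k * t ^ k) _ (Hphi t Ht)). }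
  assert (HN0 : 0 < INR N) by (apply lt_0_INR; lia).
  set (psi := fun t => t ^ N * (PSeries b t - M / INR N)).
  set (dpsi := fun t => INR N * t ^ pred N * (PSeries b t - M / INR N) + t ^ N * dphi t).
  assert (Hpsi : forall t, 0 <= t <= 1 -> is_derive psi t (dpsi t)).
  { intros t Ht.
    assert (HD := is_derive_PSeries b t (Hbt t Ht)).
    unfold psi, dpsi.
    auto_derive.
    - now exists (PSeries (PS_derive b) t).
    - replace (Derive (fun x => PSeries b x) t) with (dphi t)
        by (symmetry; exact (is_derive_unique _ _ _ HD)).
      ring. }
  destruct (MVT_gen psi 0 1 dpsi) as [x [Hx E]].
  - intros t; rewrite Rmin_left, Rmax_right by lra; intros Ht; apply Hpsi; lra.
  - intros t; rewrite Rmin_left, Rmax_right by lra; intros Ht.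
    apply continuity_pt_filterlim, (ex_derive_continuous (K := R_AbsRing) (V := R_NormedModule)).
    eexists; now apply Hpsi.
  - rewrite Rmin_left, Rmax_right in Hx by lra.
    assert (Hd : dpsi x <= 0).
    { unfold dpsi.
      replace (x ^ N) with (x ^ pred N * x) by (destruct N; [lia|simpl; ring]).
      replace (INR N * x ^ pred N * (PSeries b x - M / INR N) + x ^ pred N * x * dphi x)
        with (x ^ pred N * (INR N * PSeries b x + x * dphi x - M)) by (field; lra).
      generalize (pow_le x (pred N) (proj1 Hx)) (Heuler x Hx); nra. }
    (* Here [1 <= N] makes [psi 0] vanish, so the mean value theorem gives [psi 1 <= 0]. *)
    unfold psi in E; rewrite pow1, Hphi1, pow_i in E by lia; lra.
Qed.

(** * From the derivative to the function *)

(** Without their constant terms both series vanish to order [n]. After division by [z ^ n] their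
    coefficients differ by the factor [k + (q + n)], so Schwarz's lemma followed by the radial
    estimate with [N = q + n] bounds the quotient by [D]. *)
Lemma deviation_bound (d : nat -> C) (H K : C -> C) (n q : nat) (D : R) :
  (1 <= n)%nat -> 0 < D -> pow_series d H -> pow_series (fun k => (INR (k + q) * d k)%C) K ->
  (forall k, (0 < k < n)%nat -> d k = 0) ->
  (forall z, unit_disc z -> Cmod (K z - INR q * d 0%nat) <= D * INR (q + n)) ->
  forall z, unit_disc z -> Cmod (H z - d 0%nat) < D.
Proof.
  intros Hn HD HH HK H0 HM z Hz.
  set (G := fun z => (K z - INR q * d 0%nat)%C).
  set (W := fun z => (H z - d 0%nat)%C).
  assert (HG := pow_series_minus _ _ _ _ HK (pow_series_const (INR q * d 0%nat))).
  assert (HW := pow_series_minus _ _ _ _ HH (pow_series_const (d 0%nat))).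
  assert (HG' := fun H => schwarz _ G n _ HG H HM).
  apply pow_series_quot_pow with (j := n) in HG.
  2: { intros [|k] Hk; [cbn [Nat.add]; ring|rewrite H0 by lia; ring]. }
  assert (HW0 := pow_series_at_0 _ _ HW).
  apply pow_series_quot_pow with (j := n) in HW.
  2: { intros [|k] Hk; [ring|rewrite H0 by lia; ring]. }
  assert (Hbound : forall z, unit_disc z -> Cmod (quot_pow W n z) <= D).
  { intros y Hy.
    replace D with (D * INR (q + n) / INR (q + n)) by (field; apply not_0_INR; lia).
    refine (pow_series_integral_bound (fun k => d (n + k)%nat) _ (quot_pow G n) (q + n) _ _ _ _ _ y Hy).
    - lia.
    - apply pow_series_ext with (2 := HW); intros k.
      destruct n; [lia|simpl; ring].
    - apply pow_series_ext with (2 := HG); intros k.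
      replace (k + (q + n))%nat with (n + k + q)%nat by lia.
      destruct n; [lia|cbn [Nat.add]; ring].
    - apply HG'.
      intros [|k] Hk; [cbn [Nat.add]; ring|rewrite H0 by lia; ring]. }
  change (Cmod (W z) < D).
  (* Strictness comes from [0 < D] at the origin and from [Cmod z ^ n < 1] elsewhere. *)
  destruct (Ceq_dec z 0) as [->|Hz0].
  - unfold W; rewrite HW0.
    replace (d 0%nat - d 0%nat)%C with (RtoC 0) by ring; now rewrite Cmod_0.
  - specialize (Hbound z Hz); unfold quot_pow in Hbound.
    destruct (Ceq_dec z 0) as [|_]; [contradiction|].
    assert (Hzn : (z ^ n)%C <> 0) by now apply Cpow_nz.
    replace (W z) with (W z / z ^ n * z ^ n)%C by (field; exact Hzn).
    rewrite Cmod_mult, Cmod_pow.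
    assert (Hpow : Cmod z ^ n < 1).
    { apply pow_lt_1_compat; [|lia].
      split; [apply Cmod_ge_0|exact Hz]. }
    generalize (Cmod_ge_0 (W z / z ^ n)) (pow_le _ n (Cmod_ge_0 z)); nra.
Qed.

(** Expanding the squares identifies the square root in the theorem as the length of a chord of the
    unit circle. *)
Lemma Cmod_cis_minus (s t : R) : Cmod (cis s - cis t) = sqrt (2 * (1 - cos (s - t))).
Proof.
  unfold Cmod, cis; simpl fst; simpl snd; f_equal; rewrite cos_minus.
  generalize (sin2_cos2 s) (sin2_cos2 t); unfold Rsqr; intros; nra.
Qed.

Theorem theorem2p11 :
  forall (n p m Om : nat) (lam : R) (f g : C -> C) (alpha beta delta : R),
    (1 <= n)%nat -> (1 <= p)%nat -> (m < p)%nat ->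
    0 <= lam <= 1 ->
    in_class n p lam m Om f ->
    in_class n p lam m Om g ->
    - PI <= alpha - beta <= PI ->
    delta > INR (fact p) / (INR (p + n - m) * INR (fact (p - m - 1)))
            * sqrt (2 * (1 - cos (alpha - beta))) ->
    (forall z : C, unit_disc z ->
       Cmod (cis alpha * quot_pow (C_derive (calF p m Om lam f)) (p - m - 1) z
             - cis beta * quot_pow (C_derive (calF p m Om lam g)) (p - m - 1) z)%C
       < delta * INR (p + n - m)
         - INR (fact p) / INR (fact (p - m - 1))
           * sqrt (2 * (1 - cos (alpha - beta)))) ->
    forall z : C, unit_disc z ->
      Cmod (cis alpha * quot_pow (calF p m Om lam f) (p - m) z
            - cis beta * quot_pow (calF p m Om lam g) (p - m) z)%C
      < delta + INR (fact p) / INR (fact (p - m))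
                * sqrt (2 * (1 - cos (alpha - beta))).
Proof.
  intros n p m Om lam f g alpha beta delta Hn _ Hmp _ [a [Ha _]] [b [Hb _]] _ Hdelta Hyp z Hz.
  destruct (calF_expansion n p m Om lam a f Hn Hmp Ha) as [cf [Hcf [Hf1 Hf0]]].
  destruct (calF_expansion n p m Om lam b g Hn Hmp Hb) as [cg [Hcg [Hg1 Hg0]]].
  rewrite <- Cmod_cis_minus in *.
  set (s := Cmod (cis alpha - cis beta)) in *.
  assert (Hs : 0 <= s) by apply Cmod_ge_0.
  (* From here on [q] denotes [p - m - 1], and [S q] is [p - m]. *)
  destruct (Nat.lt_exists_pred 0 (p - m)) as [q [Hq _]]; [lia|].
  replace (p + n - m)%nat with (S q + n)%nat in * by lia.
  rewrite Hq in *; replace (S q - 1)%nat with q in * by lia.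
  assert (Hfq := INR_fact_lt_0 q).
  assert (HSq : 0 < INR (S q)) by (apply lt_0_INR; lia).
  assert (Hfp := INR_fact_lt_0 p).
  set (d := fun k => (cis alpha * cf (S q + k)%nat - cis beta * cg (S q + k)%nat)%C).
  assert (Hd0 : d 0%nat = ((cis alpha - cis beta) * RtoC (INR (fact p) / INR (fact (S q))))%C).
  { unfold d; rewrite Nat.add_0_r, Hf1, Hg1, RtoC_div by apply INR_fact_neq_0; ring. }
  assert (Hmod0 : Cmod (d 0%nat) = INR (fact p) / INR (fact (S q)) * s).
  { rewrite Hd0, Cmod_mult, Cmod_R, Rabs_pos_eq; [unfold s; ring|].
    apply Rlt_le, Rdiv_lt_0_compat; [exact Hfp|apply INR_fact_lt_0]. }
  (* The lower bound on [delta] is nonnegative, being a positive factor times a modulus. *)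
  assert (Hdelta0 : 0 < delta).
  { eapply Rle_lt_trans; [|exact Hdelta].
    apply Rmult_le_pos; [|exact Hs].
    apply Rlt_le, Rdiv_lt_0_compat; [exact Hfp|].
    apply Rmult_lt_0_compat; [apply lt_0_INR; lia|exact Hfq]. }
  assert (Hf0' : forall k, (k < S q)%nat -> cf k = 0) by (intros; apply Hf0; lia).
  assert (Hg0' : forall k, (k < S q)%nat -> cg k = 0) by (intros; apply Hg0; lia).
  set (H := fun z => (cis alpha * quot_pow (calF p m Om lam f) (S q) z
                      - cis beta * quot_pow (calF p m Om lam g) (S q) z)%C).
  set (K := fun z => (cis alpha * quot_pow (C_derive (calF p m Om lam f)) q z
                      - cis beta * quot_pow (C_derive (calF p m Om lam g)) q z)%C).
  assert (HH : pow_series d H).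
  { apply (pow_series_minus (fun k => cis alpha * cf (S q + k)%nat)%C
             (fun k => cis beta * cg (S q + k)%nat)%C);
      apply pow_series_scal, pow_series_quot_pow; assumption. }
  assert (HK : pow_series (fun k => (INR (k + S q) * d k)%C) K).
  { apply pow_series_ext with
      (fun k => (cis alpha * deriv_coef cf (q + k) - cis beta * deriv_coef cg (q + k))%C).
    (* The derivative at exponent [q + k] carries the factor [S (q + k)], which is [k + S q]. *)
    - intros k; unfold d, deriv_coef.
      replace (k + S q)%nat with (S (q + k)) by lia; cbn [Nat.add]; ring.
    - apply pow_series_minus; apply pow_series_scal, pow_series_quot_pow;
        try (now apply pow_series_C_derive); intros k Hk; unfold deriv_coef;
        [rewrite Hf0' by lia|rewrite Hg0' by lia]; ring. }
  assert (Hdev : Cmod (H z - d 0%nat) < delta).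
  { apply (deviation_bound d H K n (S q)); try assumption.
    - intros k Hk; unfold d; rewrite Hf0, Hg0 by lia; ring.
    - intros y Hy.
      eapply Rle_trans; [apply Cmod_triangle|].
      rewrite Cmod_opp, Cmod_mult, Hmod0, Cmod_R, Rabs_pos_eq by apply pos_INR.
      specialize (Hyp y Hy); fold (K y) in Hyp.
      (* Since [S q] cancels in [(S q)!], the term subtracted in the hypothesis is exactly the cost
         of removing the constant [INR (S q) * d 0], which leaves [delta * INR (S q + n)]. *)
      replace (INR (S q) * (INR (fact p) / INR (fact (S q)) * s))
        with (INR (fact p) / INR (fact q) * s)
        by (rewrite fact_simpl, mult_INR; field; lra).
      lra. }
  change (Cmod (H z) < delta + INR (fact p) / INR (fact (S q)) * s).
  rewrite <- Hmod0.
  replace (H z) with ((H z - d 0%nat) + d 0%nat)%C by ring.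
  eapply Rle_lt_trans; [apply Cmod_triangle|lra].
Qed.
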